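(* Let $K:\mathcal X\to\mathcal Y$ be a compact linear operator with $\|K\|=1$, and let $\{\alpha_n\}_{n\in\mathbb N},\{r_n\}_{n\in\mathbb N}$ be sequences of positive real numbers. (1) If $\sup_{k\in\mathbb N}r_k=r\in[0,\infty)$, then the nonstationary iterated weighted Tikhonov (NSIWT) method converges if and only if $\sum_{k=1}^n\alpha_k^{-1}$ diverges as $n\to\infty$. (2) Let $\lim_{k\to\infty}r_k=\infty$ monotonically. If $\big(\sum_{k=1}^n\alpha_k^{-1}\big)^{-1}=o(\sigma^{r_n+1})$ as $n\to\infty$ for every $\sigma\in\sigma(K)\setminus\{0\}$, then the NSIWT method converges.
   Context: $\mathcal X,\mathcal Y$ are Hilbert spaces; $K^\dagger$ is the Moore-Penrose generalized inverse. $(\sigma_m;v_m,u_m)$ is the singular value expansion of $K$ ($Kv_m=\sigma_mu_m$, $K^*u_m=\sigma_mv_m$, $\sigma_m>0$ decreasing), so $\sigma_1=\|K\|=1$; $\sigma(K)$ denotes the closure of $\{\sigma_m\}$. NSIWT: $x_{\alpha_0,r_0}^0=0$ and, for $n\ge1$, $$\big[(K^*K)^{\frac{r_n+1}2}+\alpha_nI\big]x_{\alpha_n,r_n}^n=(K^*K)^{\frac{r_n-1}2}K^*y+\alpha_nx_{\alpha_{n-1},r_{n-1}}^{n-1},$$ where $(K^*K)^{\frac{r-1}2}K^*y:=\sum_m\sigma_m^{r}\langle y,u_m\rangle v_m$. The method ''converges'' if for every $y$ in the range of $K$ the iterates $x_{\alpha_n,r_n}^n$ converge in norm to $x^\dagger=K^\dagger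 y$ as $n\to\infty$. *)

(* Defs.v *)
From HB Require Import structures.
From mathcomp Require Import all_boot all_order all_algebra.
From mathcomp Require Import sesquilinear complex.
From mathcomp Require Import all_classical all_reals all_analysis.

Set Implicit Arguments.
Unset Strict Implicit.
Unset Printing Implicit Defensive.

Import Order.TTheory GRing.Theory Num.Theory.
Import numFieldNormedType.Exports.

Local Open Scope classical_set_scope.
Local Open Scope ring_scope.

(* The scalar field F of the Hilbert spaces is the field of real or of complex
   numbers.  Both cases are treated at once: F is a numeric field whose real
   elements form a copy of R and whose norm comes from a conjugation.  The
   axioms force F to be R, or to be the quadratic extension R[i]; instances
   for both fields follow. *)
Record scalars (R : realType) (F : numFieldType) := Scalars {
  scal_of_real : {rmorphism R -> F} ;
  scal_conj : involutive_rmorphism F ;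
  scal_le : forall a b : R, (scal_of_real a <= scal_of_real b) = (a <= b) ;
  scal_real : forall z : F, z \is Num.real -> exists a : R, z = scal_of_real a ;
  scal_norm : forall z : F, z * scal_conj z = `|z| ^+ 2
}.

Section ScalarsInstances.
Variable R : realType.

Fact real_scalars_norm (z : R) : z * z = `|z| ^+ 2.
Proof. by rewrite real_normK ?num_real// expr2. Qed.

Definition real_scalars : scalars R R :=
  @Scalars R R idfun idfun (fun _ _ => erefl)
    (fun z _ => ex_intro _ z erefl) real_scalars_norm.

Fact complex_scalars_real (z : R[i]) : z \is Num.real ->
  exists a : R, z = real_complex R a.
Proof. by move/complex_realP => [a ->]; exists a. Qed.

Fact complex_scalars_norm (z : R[i]) : z * Num.conj z = `|z| ^+ 2.
Proof. by rewrite normCK. Qed.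

Definition complex_scalars : scalars R R[i] :=
  @Scalars R R[i] (real_complex R) (@Num.conj R[i]) (@lecR R)
    complex_scalars_real complex_scalars_norm.

End ScalarsInstances.

Section Operators.
Context {R : realType} {F : numFieldType} (S : scalars R F).
Context {X Y : completeNormedModType F}.
Variables (dotX : {dot X for scal_conj S}) (dotY : {dot Y for scal_conj S}).
Implicit Types (K : X -> Y) (x : X) (y : Y).

Local Notation "a %:S" := (scal_of_real S a) (at level 1, format "a %:S").

Definition compact_operator K :=
  forall A : set X, bounded_set A -> precompact (K @` A).

(* The norms live in F, hence the transfer to R. *)
Definition opnorm K : R :=
  sup [set a : R | exists2 x, `|x| <= 1 & a%:S = `|K x|].

Definition adjoint K (Ks : Y -> X) := forall x y, dotY (K x) y = dotX x (Ks y).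

(* For y in R(K) + R(K)^\perp, the Moore-Penrose generalized inverse maps y to
   the unique x in N(K)^\perp such that y - K x is in R(K)^\perp, that is, to
   the inverse image under the restriction of K to N(K)^\perp of the component
   of y in R(K). *)
Definition pinv K y : X :=
  xget 0 [set x | (forall z, K z = 0 -> dotX x z = 0) /\
                  (forall z, dotY (y - K x) (K z) = 0)].

(* A singular system is indexed by {m | m < N} if K has finite rank N
   (rk = Some N), and by all of nat otherwise (rk = None). *)
Definition in_rank (rk : option nat) (m : nat) : bool :=
  if rk is Some N then (m < N)%N else true.

(* sigma 0 is the largest singular value; singular values are repeated
   according to multiplicity.  The last clause says that K vanishes on the
   orthogonal complement of the v m. *)
Record sve K (Ks : Y -> X) (rk : option nat)
    (sigma : nat -> R) (v : nat -> X) (u : nat -> Y) : Prop := Sve {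
  sve_gt0 : forall m, in_rank rk m -> 0 < sigma m ;
  sve_noninc : forall m n, in_rank rk n -> (m <= n)%N -> sigma n <= sigma m ;
  sve_orthoX : forall m n, in_rank rk m -> in_rank rk n ->
    dotX (v m) (v n) = (m == n)%:R ;
  sve_orthoY : forall m n, in_rank rk m -> in_rank rk n ->
    dotY (u m) (u n) = (m == n)%:R ;
  sve_K : forall m, in_rank rk m -> K (v m) = (sigma m)%:S *: u m ;
  sve_Ks : forall m, in_rank rk m -> Ks (u m) = (sigma m)%:S *: v m ;
  sve_expand : forall x,
    (fun n => \sum_(0 <= m < n | in_rank rk m)
                ((sigma m)%:S * dotX x (v m)) *: u m) @ \oo --> K x
}.

Section Method.
Variables (rk : option nat) (sigma : nat -> R) (v : nat -> X) (u : nat -> Y).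

Definition singular_spectrum : set R := closure (sigma @` [set m | in_rank rk m]).

(* (K^* K)^s for s > 0, by the functional calculus: the nonzero eigenvalues
   of K^* K are the (sigma m)^2. *)
Definition KsK_pow (s : R) x : X :=
  limn (fun n => \sum_(0 <= m < n | in_rank rk m)
                   (((sigma m ^+ 2) `^ s)%:S * dotX x (v m)) *: v m).

(* (K^* K)^((r - 1) / 2) K^* *)
Definition KsK_pow_Ks (r : R) y : X :=
  limn (fun n => \sum_(0 <= m < n | in_rank rk m)
                   ((sigma m `^ r)%:S * dotY y (u m)) *: v m).

Variables (alpha r : nat -> R).

(* alpha 0 and r 0 are not used.  As alpha n > 0, the operator on the
   left-hand side is invertible, so each step has exactly one solution. *)
Fixpoint nsiwt y (n : nat) : X :=
  if n is n'.+1 then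
    xget 0 [set x | KsK_pow ((r n + 1) / 2) x + (alpha n)%:S *: x =
                    KsK_pow_Ks (r n) y + (alpha n)%:S *: nsiwt y n']
  else 0.

Definition nsiwt_converges K :=
  forall y, range K y -> nsiwt y @ \oo --> pinv K y.

End Method.
End Operators.

(* Main.v *)
Require Import Defs.
From HB Require Import structures.
From mathcomp Require Import all_boot all_order all_algebra.
From mathcomp Require Import sesquilinear.
From mathcomp Require Import all_classical all_reals all_analysis.
From mathcomp Require Import ring.

(** The iteration is diagonal in the singular system.  Let y = K z and let
    a_m be the coefficient of z on v_m.  The component of the generalized
    solution on v_m is a_m (pinv_synth), and comparing components in the
    defining equation of step k shows that this step multiplies the error on
    v_m by alpha_k / (sigma_m ^ (r_k + 1) + alpha_k).  Hence (error_synth)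
    after n steps the error is the sum over m of d_m(n) a_m v_m, where
      d_m(n) = prod_(1 <= k <= n) (1 + sigma_m ^ (r_k + 1) / alpha_k)^-1.
    All these factors lie in [0, 1], so by Bessel's inequality the tail of the
    series in m is small uniformly in n (synth_cvg0), and the method converges
    for every z as soon as d_m(n) tends to 0 for each m.  Conversely
    the choice z = v_m shows that this condition is necessary.

    Let L_m(n) be the sum over k <= n of sigma_m ^ (r_k + 1) / alpha_k.  The
    estimates expR (- L_m(n)) <= d_m(n) <= (1 + L_m(n))^-1 (damp_ge, damp_le)
    turn d_m(n) --> 0 into the divergence of L_m.  Let A(n) be the sum over
    k <= n of 1 / alpha_k.  Since sigma_m <= |K| = 1, L_m(n) <= A(n), so that
    a convergent A keeps every d_m away from 0; and the smallest power
    sigma_m ^ (r_k + 1) with k <= n is attained at the largest exponent.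
    For bounded exponents this gives L_m(n) >= sigma_m ^ (sup r + 1) A(n), and
    for nondecreasing exponents L_m(n) >= sigma_m ^ (r_n + 1) A(n), which the
    little-o hypothesis at sigma_m sends to infinity. *)

Set Implicit Arguments.
Unset Strict Implicit.
Unset Printing Implicit Defensive.

Import Order.TTheory GRing.Theory Num.Theory.
Import numFieldNormedType.Exports.

Local Open Scope classical_set_scope.
Local Open Scope ring_scope.

(** * Real scalars and orthonormal systems *)

Section Scalars.
Context {R : realType} {F : numFieldType} (S : scalars R F).

Local Notation "a %:S" := (scal_of_real S a) (at level 1, format "a %:S").

Lemma scal_lt (a b : R) : (a%:S < b%:S) = (a < b).
Proof. by rewrite !lt_def scal_le (inj_eq (fmorph_inj _)). Qed.

Lemma scal_ge0E (z : F) : 0 <= z -> exists2 a : R, 0 <= a & z = a%:S.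
Proof.
move=> z0; have [a za] := scal_real S (ger0_real z0).
by exists a => //; rewrite -(scal_le S) rmorph0 -za.
Qed.

Lemma scal_gt0E (z : F) : 0 < z -> exists2 a : R, 0 < a & z = a%:S.
Proof.
move=> z0; have [a _ za] := scal_ge0E (ltW z0).
by exists a => //; rewrite -scal_lt rmorph0 -za.
Qed.

Lemma scal_norm_real (a : R) : `|a%:S| = `|a|%:S.
Proof.
have [a0|a0] := leP 0 a.
  by rewrite !ger0_norm// -(rmorph0 (scal_of_real S)) scal_le.
by rewrite !ltr0_norm ?rmorphN// -(rmorph0 (scal_of_real S)) scal_lt.
Qed.

(** On a real scalar t the identity t * conj t = t ^ 2 leaves no choice. *)
Lemma scal_conj_real (a : R) : scal_conj S a%:S = a%:S.
Proof.
have [->|a0] := eqVneq a 0; first by rewrite !rmorph0.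
have aS0 : a%:S != 0 by rewrite fmorph_eq0.
apply: (mulfI aS0).
by rewrite scal_norm scal_norm_real -rmorphXn real_normK ?num_real// rmorphXn expr2.
Qed.

End Scalars.

Section Orthonormal.
Context {R : realType} {F : numFieldType} (S : scalars R F).
Context {X : completeNormedModType F} (dot : {dot X for scal_conj S}).
Hypothesis hdot : forall x : X, dot x x = `|x| ^+ 2.

Local Notation "a %:S" := (scal_of_real S a) (at level 1, format "a %:S").

Lemma dotC (x y : X) : dot x y = scal_conj S (dot y x).
Proof. by rewrite (hermC dot) expr0 mul1r. Qed.

Lemma dotZl (a : F) (x y : X) : dot (a *: x) y = a * dot x y.
Proof. exact: linearZl_LR. Qed.

Lemma dotZr (a : F) (x y : X) : dot x (a *: y) = scal_conj S a * dot x y.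
Proof. exact: linearZr_LR. Qed.

Lemma dotDl (x y z : X) : dot (x + y) z = dot x z + dot y z.
Proof. exact: linearDl. Qed.

Lemma dotBl (x y z : X) : dot (x - y) z = dot x z - dot y z.
Proof. exact: linearBl. Qed.

Lemma dotBr (x y z : X) : dot x (y - z) = dot x y - dot x z.
Proof. exact: linearBr. Qed.

Lemma dot_suml (s : seq nat) (P : pred nat) (f : nat -> X) (z : X) :
  dot (\sum_(m <- s | P m) f m) z = \sum_(m <- s | P m) dot (f m) z.
Proof. exact: linear_sumlz. Qed.

Lemma dot_sumr (s : seq nat) (P : pred nat) (f : nat -> X) (z : X) :
  dot z (\sum_(m <- s | P m) f m) = \sum_(m <- s | P m) dot z (f m).
Proof. exact: linear_sumr. Qed.

Lemma dot_norm_eq0 (x : X) : (dot x x == 0) = (x == 0).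
Proof. by rewrite hdot sqrf_eq0 normr_eq0. Qed.

Context {P : pred nat} {e : nat -> X}.
Hypothesis he : forall m n, P m -> P n -> dot (e m) (e n) = (m == n)%:R.

Lemma dot_sum_coef (s : seq nat) (c : nat -> F) i : uniq s -> P i ->
  dot (\sum_(m <- s | P m) c m *: e m) (e i) = if i \in s then c i else 0.
Proof.
move=> us Pi; rewrite linear_sumlz.
have -> : \sum_(m <- s | P m) dot (c m *: e m) (e i) =
    \sum_(m <- s | P m) (if m == i then c i else 0).
  apply: eq_bigr => m Pm; rewrite dotZl he//.
  by case: eqP => [->|_]; rewrite ?mulr1 ?mulr0.
case: ifP => si.
  rewrite big_mkcond (bigD1_seq i)//= Pi eqxx big1 ?addr0// => m /negbTE ->.
  by rewrite if_same.
rewrite big_seq_cond big1// => m /andP[sm _].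
by case: eqP => // mi; rewrite -mi sm in si.
Qed.

Lemma normsq_sum_coef (s : seq nat) (c : nat -> F) : uniq s ->
  `|\sum_(m <- s | P m) c m *: e m| ^+ 2 = \sum_(m <- s | P m) `|c m| ^+ 2.
Proof.
move=> us; rewrite -hdot dot_sumr [LHS]big_seq_cond [RHS]big_seq_cond.
apply: eq_bigr => m /andP[sm Pm].
by rewrite dotZr dot_sum_coef// sm mulrC scal_norm.
Qed.

(** The sum p of the components of x along the system satisfies
    dot x p = dot p p, so that |x| ^ 2 - |p| ^ 2 = |x - p| ^ 2. *)
Lemma bessel (s : seq nat) x : uniq s ->
  \sum_(m <- s | P m) `|dot x (e m)| ^+ 2 <= `|x| ^+ 2.
Proof.
move=> us; pose p := \sum_(m <- s | P m) dot x (e m) *: e m.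
have xp : dot x p = dot p p.
  rewrite hdot normsq_sum_coef// dot_sumr; apply: eq_bigr => m Pm.
  by rewrite dotZr mulrC scal_norm.
have px : dot p x = dot p p by rewrite dotC xp -dotC.
rewrite -normsq_sum_coef// -/p -!hdot -subr_ge0.
suff -> : dot x x - dot p p = dot (x - p) (x - p).
  by rewrite hdot exprn_ge0.
by rewrite dotBl !dotBr xp px subrr subr0.
Qed.

Lemma norm_coef_le x m : P m -> `|dot x (e m)| <= `|x|.
Proof.
move=> Pm; have := @bessel [:: m] x erefl.
by rewrite big_mkcond big_seq1 Pm ler_sqr// nnegrE.
Qed.

End Orthonormal.

(** * Series in an orthonormal system *)

Section Expansions.
Context {R : realType} {F : numFieldType} (S : scalars R F).
Context {X : completeNormedModType F} (dot : {dot X for scal_conj S}).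
Hypothesis hdot : forall x : X, dot x x = `|x| ^+ 2.

Local Notation "a %:S" := (scal_of_real S a) (at level 1, format "a %:S").

(** Bessel's inequality for the one-vector system y / |y|. *)
Lemma cauchy_schwarz (x y : X) : `|dot x y| <= `|x| * `|y|.
Proof.
have [->|y0] := eqVneq y 0.
  by have -> : dot x 0 = 0 by [exact: linear0r]; rewrite normr0 mulr_ge0.
have ny0 : `|y| != 0 by rewrite normr_eq0.
have unit_y m n : pred1 0%N m -> pred1 0%N n ->
    dot (`|y|^-1 *: y) (`|y|^-1 *: y) = (m == n)%:R.
  move=> /eqP -> /eqP ->; rewrite dotZl dotZr hdot mulrA scal_norm normfV.
  by rewrite normr_id exprVn mulVf// expf_neq0.
have conjV : scal_conj S `|y|^-1 = `|y|^-1.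
  by have [a _ ->] := scal_ge0E S (normr_ge0 y); rewrite -fmorphV scal_conj_real.
have := norm_coef_le hdot unit_y x (eqxx 0%N).
by rewrite dotZr conjV normrM normfV normr_id mulrC ler_pdivrMr ?normr_gt0.
Qed.

Lemma norm_lim_le (f : nat -> X) (l : X) (b : F) :
  f n @[n --> \oo] --> l -> (\forall n \near \oo, `|f n| <= b) -> `|l| <= b.
Proof.
move=> fl fb; apply/ler_addgt0Pr => d d0.
have /cvgrPdist_le/(_ d d0) fld := fl.
near \oo => n.
rewrite -(subrK (f n) l) addrC (le_trans (ler_normD _ _))// lerD//.
  by near: n.
by near: n.
Unshelve. all: by end_near. Qed.

Lemma dot_lim_eq0 (f : nat -> X) (l w : X) : f n @[n --> \oo] --> l ->
  (\forall n \near \oo, dot (f n) w = 0) -> dot l w = 0.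
Proof.
move=> fl fw; apply/normr0_eq0/eqP; rewrite eq_le normr_ge0 andbT.
apply/ler_addgt0Pl => d d0; rewrite addr0.
have dw0 : 0 < d / (`|w| + 1) by rewrite divr_gt0// ltr_wpDl.
have /cvgrPdist_le/(_ _ dw0) fld := fl.
near \oo => n.
have -> : dot l w = dot (l - f n) w.
  by rewrite dotBl (near fw n) ?subr0//.
rewrite (le_trans (cauchy_schwarz _ _))//.
rewrite (@le_trans _ _ (d / (`|w| + 1) * `|w|))//.
  by rewrite ler_wpM2r//; near: n.
by rewrite mulrAC ler_pdivrMr ?ltr_wpDl// ler_wpM2l ?(ltW d0)// lerDl.
Unshelve. all: by end_near. Qed.

Context {P : pred nat} {e : nat -> X}.
Hypothesis he : forall m n, P m -> P n -> dot (e m) (e n) = (m == n)%:R.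

Definition partial_sum (c : nat -> F) (n : nat) : X :=
  \sum_(0 <= m < n | P m) c m *: e m.

Definition synth (c : nat -> F) : X := limn (partial_sum c).

Definition dominated (c : nat -> F) (x : X) :=
  forall m, P m -> `|c m| <= `|dot x (e m)|.

Lemma weight_dominated (w : nat -> R) (x : X) :
  (forall m, P m -> 0 <= w m <= 1) ->
  dominated (fun m => (w m)%:S * dot x (e m)) x.
Proof.
move=> w01 m Pm; have /andP[wm0 wm1] := w01 m Pm.
rewrite normrM scal_norm_real ler_piMl// ger0_norm//.
by rewrite -(rmorph1 (scal_of_real S)) scal_le.
Qed.

Lemma partial_sumB c m n : (m <= n)%N ->
  partial_sum c n - partial_sum c m = \sum_(m <= k < n | P k) c k *: e k.
Proof.
move=> mn; apply/eqP; rewrite subr_eq addrC; apply/eqP.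
exact: big_cat_nat.
Qed.

(** The squared coefficients are real numbers whose partial sums are bounded by
    Bessel's inequality.  The completeness of R supplies an N at which these
    sums are within d ^ 2 of their supremum. *)
Lemma coef_tail (x : X) (d : R) : 0 < d -> exists N, forall n,
  \sum_(N <= m < n | P m) `|dot x (e m)| ^+ 2 <= d%:S ^+ 2.
Proof.
move=> d0; have /choice[b hb] : forall m, exists b : R, `|dot x (e m)| = b%:S.
  by move=> m; have [a _ ->] := scal_ge0E S (normr_ge0 (dot x (e m))); exists a.
have sumS m n : \sum_(m <= k < n | P k) `|dot x (e k)| ^+ 2 =
    (\sum_(m <= k < n | P k) b k ^+ 2)%:S.
  by rewrite rmorph_sum; apply: eq_bigr => k _; rewrite hb rmorphXn.
pose s n := \sum_(0 <= k < n | P k) b k ^+ 2.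
have sup_s : has_sup (range s).
  split; first by exists (s 0%N), 0%N.
  have [B _ xB] := scal_ge0E S (normr_ge0 x).
  exists (B ^+ 2) => _ [n _ <-].
  rewrite -(scal_le S) -sumS rmorphXn -xB.
  by apply: (bessel hdot he); exact: iota_uniq.
have [_ [N _ <-] sN] := sup_adherent (exprn_gt0 2 d0) sup_s.
exists N => n; rewrite sumS -rmorphXn scal_le.
have [nN|/ltnW Nn] := leqP n N; first by rewrite big_geq// exprn_ge0// ltW.
have sn : s n <= sup (range s) by apply: ub_le_sup; [exact: sup_s.2|exists n].
rewrite -(lerD2l (s N)) /s -(big_cat_nat (leq0n N) Nn)//= -/(s n).
by rewrite (le_trans sn)// -lerBlDr ltW.
Qed.

(** The hypothesis on N concerns x alone, so that one N serves all sequences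
    dominated by the coefficients of x. *)
Lemma dominated_tail (c : nat -> F) (x : X) (d : R) N : 0 <= d -> dominated c x ->
  (forall n, \sum_(N <= m < n | P m) `|dot x (e m)| ^+ 2 <= d%:S ^+ 2) ->
  forall n, (N <= n)%N -> `|partial_sum c n - partial_sum c N| <= d%:S.
Proof.
move=> d0 cx xd n Nn; rewrite partial_sumB//.
rewrite -(@ler_sqr F) ?nnegrE// -?(rmorph0 (scal_of_real S)) ?scal_le//.
rewrite (normsq_sum_coef hdot he) ?iota_uniq//.
rewrite (le_trans _ (xd n))// ler_sum// => m Pm.
by rewrite ler_sqr ?nnegrE// cx.
Qed.

Lemma dominated_is_cvg (c : nat -> F) (x : X) : dominated c x -> cvgn (partial_sum c).
Proof.
move=> cx; apply/cauchy_cvgP/cauchy_exP => eps /(scal_gt0E S)[d d0 ->].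
have d20 : 0 < d / 2 by rewrite divr_gt0.
have [N xN] := coef_tail x d20.
have d2d : (d / 2)%:S < d%:S.
  by rewrite scal_lt gtr_pMr// invf_lt1// ltr1n.
exists (partial_sum c N).
suff : \forall n \near \oo, ball (partial_sum c N) d%:S (partial_sum c n) by [].
near=> n; rewrite -ball_normE/= distrC (le_lt_trans _ d2d)//.
by rewrite (dominated_tail (ltW d20) cx xN)//; near: n; exists N.
Unshelve. all: by end_near. Qed.

Lemma synth_coef (c : nat -> F) i : cvgn (partial_sum c) -> P i ->
  dot (synth c) (e i) = c i.
Proof.
move=> cc Pi; apply/eqP; rewrite -subr_eq0; apply/eqP.
have dei : dot (c i *: e i) (e i) = c i by rewrite dotZl he// eqxx mulr1.
rewrite -dei -dotBl.
apply: (@dot_lim_eq0 (fun n => partial_sum c n - c i *: e i)).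
  by apply: cvgB => //; exact: cvg_cst.
near=> n; rewrite dotBl dei /partial_sum (dot_sum_coef he) ?iota_uniq//.
by rewrite mem_index_iota /= ifT ?subrr//; near: n; exists i.+1.
Unshelve. all: by end_near. Qed.

Lemma synth_orth (c : nat -> F) (w : X) : cvgn (partial_sum c) ->
  (forall m, P m -> dot w (e m) = 0) -> dot (synth c) w = 0.
Proof.
move=> cc we; apply: (@dot_lim_eq0 (partial_sum c)) => //; near=> n.
rewrite dot_suml big1// => m Pm.
by rewrite dotZl dotC we// rmorph0 mulr0.
Unshelve. all: by end_near. Qed.

Lemma eq_synth (c d : nat -> F) : (forall m, P m -> c m = d m) ->
  synth c = synth d.
Proof.
move=> cd; rewrite /synth; suff -> : partial_sum c = partial_sum d by [].
by apply/funext => n; apply: eq_bigr => m /cd ->.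
Qed.

Lemma synth0 : synth (fun=> 0) = 0.
Proof.
rewrite /synth; suff -> : partial_sum (fun=> 0) = fun=> 0 by exact: lim_cst.
by apply/funext => n; rewrite /partial_sum big1// => m _; rewrite scale0r.
Qed.

Lemma synth_lin (a : F) (c d : nat -> F) : cvgn (partial_sum c) -> cvgn (partial_sum d) ->
  synth (fun m => c m + a * d m) = synth c + a *: synth d.
Proof.
move=> cc cd; apply/cvg_lim => //.
have -> : partial_sum (fun m => c m + a * d m) = fun n => partial_sum c n + a *: partial_sum d n.
  apply/funext => n; rewrite /partial_sum scaler_sumr -big_split.
  by apply: eq_bigr => m _; rewrite scalerDl scalerA.
by apply: cvgD => //; apply: cvgZl_tmp.
Qed.

(** Dominated convergence: up to an error that does not depend on n, the series
    is a finite sum, whose terms all tend to 0. *)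
Lemma synth_cvg0 (w : nat -> nat -> R) (x : X) :
  (forall m n, P m -> 0 <= w m n <= 1) ->
  (forall m, P m -> w m n @[n --> \oo] --> 0) ->
  synth (fun m => (w m n)%:S * dot x (e m)) @[n --> \oo] --> (0 : X).
Proof.
move=> w01 w0; pose c n m := (w m n)%:S * dot x (e m).
have cx n : dominated (c n) x.
  by apply: weight_dominated => m Pm; exact: w01.
apply/cvgrPdist_le => eps /(scal_gt0E S)[d d0 ->].
have d20 : 0 < d / 2 by rewrite divr_gt0.
have [N xN] := coef_tail x d20.
have head0 : partial_sum (c n) N @[n --> \oo] --> (0 : X).
  have <- : \sum_(0 <= m < N | P m) (0 : X) = 0 by rewrite big1.
  apply: cvg_big => [|m Pm]; first exact: add_continuous.
  have <- : (0 * dot x (e m)) *: e m = 0 by rewrite mul0r scale0r.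
  apply: cvgZr_tmp; apply: cvgMl.
  apply/cvgrPdist_le => _ /(scal_gt0E S)[a a0 ->]; near=> n.
  rewrite sub0r normrN scal_norm_real scal_le -normrN -sub0r.
  by near: n; move/cvgrPdist_le: (w0 m Pm); apply.
have d2S : 0 < (d / 2)%:S by rewrite -(rmorph0 (scal_of_real S)) scal_lt.
near=> n; rewrite sub0r normrN.
have -> : synth (c n) = (synth (c n) - partial_sum (c n) N) + partial_sum (c n) N.
  by rewrite subrK.
rewrite [X in X%:S](splitr d) rmorphD (le_trans (ler_normD _ _))// lerD//.
  have tail : partial_sum (c n) k - partial_sum (c n) N @[k --> \oo] -->
      synth (c n) - partial_sum (c n) N.
    by apply: cvgB; [exact: dominated_is_cvg (cx n)|exact: cvg_cst].
  apply: norm_lim_le tail _; exists N => // k.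
  exact: dominated_tail (ltW d20) (cx n) xN k.
rewrite -normrN -sub0r; by near: n; move/cvgrPdist_le: head0; apply.
Unshelve. all: by end_near. Qed.

End Expansions.

Arguments partial_sum {F X} P e c n.
Arguments synth {F X} P e c.
Arguments dominated {R F S X} dot P e c x.

(** * The damping factors *)

Section Damping.
Context {R : realType} (alpha t : nat -> R).
Hypothesis halpha : forall k, (0 < k)%N -> 0 < alpha k.
Hypothesis ht : forall k, (0 < k)%N -> 0 < t k.

(** The factor by which n steps of the iteration with weights alpha multiply an
    error component on which the operator of step k acts as t k. *)
Definition damp n : R := \prod_(1 <= k < n.+1) (1 + t k / alpha k)^-1.

(** The first-order term in t of the inverse of damp. *)
Definition load n : R := \sum_(1 <= k < n.+1) t k / alpha k.

Lemma loadS n : load n.+1 = load n + t n.+1 / alpha n.+1.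
Proof. by rewrite /load big_nat_recr. Qed.

Lemma dampS n : damp n.+1 = damp n * (1 + t n.+1 / alpha n.+1)^-1.
Proof. by rewrite /damp big_nat_recr. Qed.

Lemma ratio_gt0 k : (0 < k)%N -> 0 < t k / alpha k.
Proof. by move=> k0; rewrite divr_gt0 ?ht ?halpha. Qed.

Lemma damp01 n : 0 <= damp n <= 1.
Proof.
have ratio k : (1 <= k < n.+1)%N -> 0 <= (1 + t k / alpha k)^-1 <= 1.
  move=> /andP[k0 _]; have rk := ratio_gt0 k0.
  have r1 : 0 < 1 + t k / alpha k by rewrite addr_gt0.
  by rewrite invr_ge0 (ltW r1)/= invf_le1// lerDl ltW.
rewrite /damp big_nat prodr_ile1//.
by rewrite andbT prodr_ge0// => k /ratio/andP[].
Qed.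

Lemma load_ge0 n : 0 <= load n.
Proof.
by rewrite /load big_nat sumr_ge0// => k /andP[k0 _]; exact/ltW/ratio_gt0.
Qed.

(** Expanding the product of the 1 + t k / alpha k leaves, besides 1 + load n,
    only nonnegative terms. *)
Lemma damp_le n : damp n <= (1 + load n)^-1.
Proof.
elim: n => [|n IH]; first by rewrite /damp /load !big_geq// addr0 invr1.
have r0 : 0 < t n.+1 / alpha n.+1 by exact: ratio_gt0.
have l0 := load_ge0 n.
have r1 : 0 < 1 + t n.+1 / alpha n.+1 by rewrite addr_gt0.
have l1 : 0 < 1 + load n by rewrite ltr_wpDr.
have l2 : 0 < 1 + load n.+1 by rewrite ltr_wpDr ?load_ge0.
rewrite dampS (@le_trans _ _ ((1 + load n)^-1 * (1 + t n.+1 / alpha n.+1)^-1))//.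
  by rewrite ler_wpM2r// invr_ge0 ltW.
rewrite -invfM lef_pV2 ?posrE ?mulr_gt0// loadS.
by rewrite mulrDr mulr1 mulrDl mul1r addrA lerD2l lerDl mulr_ge0 ?(ltW r0).
Qed.

(** Each factor satisfies 1 + x <= expR x. *)
Lemma damp_ge n : expR (- load n) <= damp n.
Proof.
rewrite /load -sumrN expR_sum /damp big_nat [leRHS]big_nat.
apply: ler_prod => k /andP[k0 _]; rewrite expR_ge0/= expRN.
have r0 := ratio_gt0 k0.
by rewrite lef_pV2 ?posrE ?expR_gt0 ?addr_gt0 ?expR_ge1Dx.
Qed.

Lemma damp_cvg0 :
  (forall A : R, 0 < A -> \forall n \near \oo, A <= load n) ->
  damp n @[n --> \oo] --> 0.
Proof.
move=> load_infty; apply/cvgrPdist_le => d d0.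
have dV0 : 0 < d^-1 by rewrite invr_gt0.
near=> n; have /andP[damp0 _] := damp01 n.
rewrite sub0r normrN ger0_norm// (le_trans (damp_le n))//.
rewrite -[leRHS]invrK lef_pV2 ?posrE ?ltr_wpDr ?load_ge0//.
have nl : d^-1 <= load n by near: n; exact: load_infty.
by rewrite (le_trans nl)// lerDr.
Unshelve. all: by end_near. Qed.

End Damping.

(** * The iterates in the singular system *)

Section Iterates.
Context {R : realType} {F : numFieldType} (S : scalars R F).
Context {X Y : completeNormedModType F}.
Context (dotX : {dot X for scal_conj S}) (dotY : {dot Y for scal_conj S}).
Hypothesis hdotX : forall x : X, dotX x x = `|x| ^+ 2.
Hypothesis hdotY : forall y : Y, dotY y y = `|y| ^+ 2.
Context (K : {linear X -> Y}) (Ks : Y -> X).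
Hypothesis hKs : adjoint dotX dotY K Ks.
Context (rk : option nat) (sigma : nat -> R) (v : nat -> X) (u : nat -> Y).
Hypothesis hsve : sve dotX dotY K Ks rk sigma v u.

Local Notation "a %:S" := (scal_of_real S a) (at level 1, format "a %:S").
Local Notation P := (in_rank rk).
Local Notation synthv := (synth P v).
Local Notation coef x := (fun m => dotX x (v m)).

Let vo := sve_orthoX hsve.

Lemma coefK x m : P m -> dotY (K x) (u m) = (sigma m)%:S * dotX x (v m).
Proof. by move=> Pm; rewrite hKs (sve_Ks hsve)// dotZr scal_conj_real. Qed.

Lemma coef_cvg x : cvgn (partial_sum P v (coef x)).
Proof. by apply: (dominated_is_cvg hdotX vo (x := x)) => m _. Qed.

(** The singular value expansion of K x involves x through its coefficients
    only. *)
Lemma eq_K x x' : (forall m, P m -> dotX x (v m) = dotX x' (v m)) -> K x = K x'.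
Proof.
move=> xx'; have [_ _ _ _ _ _ expK] := hsve.
have Kx := expK x; have Kx' := expK x'.
have eq_sum : (fun n => \sum_(0 <= m < n | P m)
    ((sigma m)%:S * dotX x (v m)) *: u m) = (fun n => \sum_(0 <= m < n | P m)
    ((sigma m)%:S * dotX x' (v m)) *: u m).
  by apply/funext => n; apply: eq_bigr => m /xx' ->.
by rewrite eq_sum in Kx; exact: (cvg_unique _ Kx Kx').
Qed.

(** The coefficient of K z on u m is sigma m times that of z on v m, and
    sigma m is positive. *)
Lemma kernel_coef z m : K z = 0 -> P m -> dotX z (v m) = 0.
Proof.
move=> Kz Pm; have := coefK z Pm; rewrite Kz.
have -> : dotY 0 (u m) = 0 by exact: linear0l.
move/esym/eqP; rewrite mulf_eq0 fmorph_eq0 gt_eqF ?(sve_gt0 hsve)//=.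
by move/eqP.
Qed.

(** The synthesis of the coefficients of z has the same image as z by eq_K, and
    is orthogonal to the kernel of K by kernel_coef.  Another element with both
    properties differs from it by a vector of the kernel that is orthogonal to
    itself. *)
Lemma pinv_synth z : Defs.pinv dotX dotY K (K z) = synthv (coef z).
Proof.
have Ksynth : K (synthv (coef z)) = K z.
  by apply: eq_K => m Pm; rewrite (synth_coef hdotX vo)//; exact: coef_cvg.
apply: xget_unique.
  split=> [w Kw|w]; last by rewrite Ksynth subrr; exact: linear0l.
  apply: (synth_orth hdotX) => [|m Pm]; first exact: coef_cvg.
  exact: kernel_coef.
move=> x [xker xran]; apply/eqP; rewrite -subr_eq0.
set d := x - _.
have Kd : K d = 0.
  have KzK : K z - K x = K (z - x) by rewrite raddfB.
  have Kzx : K z - K x = 0.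
    by apply/eqP; rewrite -(dot_norm_eq0 hdotY) {2}KzK xran.
  have -> : K d = K x - K z by rewrite -Ksynth; exact: raddfB.
  by rewrite -opprB Kzx oppr0.
rewrite -(dot_norm_eq0 hdotX) {1}/d dotBl xker// sub0r oppr_eq0.
apply/eqP/(synth_orth hdotX) => [|m Pm]; first exact: coef_cvg.
exact: kernel_coef.
Qed.

Hypothesis hKnorm : opnorm S K = 1.

Lemma sigma_le1 m : P m -> sigma m <= 1.
Proof.
move=> Pm; rewrite -hKnorm; apply: ub_le_sup; last first.
  exists (v m).
    by rewrite -(@ler_sqr F) ?nnegrE// -hdotX vo// eqxx expr1n.
  have um : `|u m| = 1.
    apply/eqP; rewrite -(@eqrXn2 F 2)//.
    by rewrite -hdotY (sve_orthoY hsve)// eqxx expr1n.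
  by rewrite (sve_K hsve)// normrZ um mulr1 scal_norm_real gtr0_norm ?(sve_gt0 hsve).
(* An unbounded set has supremum 0 by convention. *)
suff hs : has_sup [set a : R | exists2 x, `|x| <= 1 & a%:S = `|K x|] by exact: hs.2.
apply: contrapT => /sup_out K0; move: hKnorm; rewrite /opnorm K0 => /eqP.
by rewrite eq_sym oner_eq0.
Qed.

(** Without singular values K would vanish, against |K| = 1. *)
Lemma in_rank0 : P 0.
Proof.
apply: contrapT => /negP P0.
have Pm m : P m = false.
  by move: P0; rewrite /in_rank; case: rk => // -[|N].
have K0 x : K x = 0.
  by rewrite (@eq_K x 0) ?linear0// => m; rewrite Pm.
move: hKnorm; rewrite /opnorm; suff -> : [set a : R | exists2 x, `|x| <= 1 &
    a%:S = `|K x|] = [set 0] by rewrite sup1 => /eqP; rewrite eq_sym oner_eq0.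
apply/seteqP; split=> [a [x _ /eqP]|_ ->] /=.
  by rewrite K0 normr0 fmorph_eq0 => /eqP.
by exists 0; rewrite ?K0 normr0// rmorph0.
Qed.

Lemma spectral_power (q : R) m : P m ->
  (sigma m ^+ 2) `^ ((q + 1) / 2) = sigma m `^ (q + 1).
Proof.
move=> Pm; rewrite -powR_mulrn ?(ltW (sve_gt0 hsve Pm))// -powRrM.
by rewrite mulrCA divff ?mulr1// pnatr_eq0.
Qed.

Lemma power01 (q : R) m : 0 <= q -> P m -> 0 <= sigma m `^ q <= 1.
Proof.
move=> q0 Pm; rewrite powR_ge0/= -[leRHS](powRr0 (sigma m)).
by rewrite ger_powR// (sve_gt0 hsve Pm) sigma_le1.
Qed.

Lemma KsK_pow_synth (q : R) x : KsK_pow dotX rk sigma v ((q + 1) / 2) x =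
  synthv (fun m => (sigma m `^ (q + 1))%:S * dotX x (v m)).
Proof. by apply: eq_synth => m Pm; rewrite spectral_power. Qed.

Lemma KsK_pow_Ks_synth (q : R) z : 0 <= q ->
  KsK_pow_Ks dotY rk sigma v u q (K z) =
  synthv (fun m => (sigma m `^ (q + 1))%:S * dotX z (v m)).
Proof.
move=> q0; apply: eq_synth => m Pm; have s0 := sve_gt0 hsve Pm.
rewrite coefK// mulrA -rmorphM powRD; last by rewrite (gt_eqF s0) implybT.
by rewrite powRr1// ltW.
Qed.

Lemma power_cvg (q : R) x : 0 <= q ->
  cvgn (partial_sum P v (fun m => (sigma m `^ (q + 1))%:S * dotX x (v m))).
Proof.
move=> q0; apply: (dominated_is_cvg hdotX vo (x := x)).
by apply: weight_dominated => m Pm; rewrite power01// addr_ge0.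
Qed.

(** On v m the operator acts as sigma m ^ (q + 1) + a > 0, so the two
    coefficient sequences agree.  As the power of the operator sees only these,
    a *: x = a *: x' remains, which also settles the part of x orthogonal to
    all v m. *)
Lemma shifted_power_inj (q a : R) x x' : 0 <= q -> 0 < a ->
  KsK_pow dotX rk sigma v ((q + 1) / 2) x + a%:S *: x =
  KsK_pow dotX rk sigma v ((q + 1) / 2) x' + a%:S *: x' -> x = x'.
Proof.
move=> q0 a0; rewrite !KsK_pow_synth => xx'.
have coef_eq m : P m -> dotX x (v m) = dotX x' (v m).
  move=> Pm; move: (congr1 (fun w => dotX w (v m)) xx').
  rewrite !dotDl !dotZl !(synth_coef hdotX vo)//; try exact: power_cvg.
  rewrite -!mulrDl -rmorphD; apply: mulfI.
  rewrite fmorph_eq0 gt_eqF// ltr_wpDl//.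
  by have /andP[] := @power01 (q + 1) m (addr_ge0 q0 ler01) Pm.
move: xx'; rewrite (@eq_synth F X P v _
  (fun m => (sigma m `^ (q + 1))%:S * dotX x' (v m))); last first.
  by move=> m Pm; rewrite coef_eq.
move/addrI/eqP; rewrite -subr_eq0 -scalerBr scaler_eq0 fmorph_eq0 gt_eqF//=.
by rewrite subr_eq0 => /eqP.
Qed.

Context (alpha r : nat -> R).
Hypothesis halpha : forall k, (0 < k)%N -> 0 < alpha k.
Hypothesis hr : forall k, (0 < k)%N -> 0 < r k.

Local Notation dampm m := (damp alpha (fun k => sigma m `^ (r k + 1))).
Local Notation loadm m := (load alpha (fun k => sigma m `^ (r k + 1))).
Local Notation iterate := (nsiwt dotX dotY rk sigma v u alpha r).

Lemma power_gt0 m : P m -> forall k, (0 < k)%N -> 0 < sigma m `^ (r k + 1).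
Proof. by move=> Pm k _; rewrite powR_gt0// (sve_gt0 hsve). Qed.

Lemma dampm01 m n : P m -> 0 <= dampm m n <= 1.
Proof. by move=> Pm; apply: damp01 => //; exact: power_gt0. Qed.

(** With t = sigma m ^ (r n + 1), a = alpha n and c the m-th component of z, the
    step reads (t + a) x_n = t c + a x_(n-1), that is,
    c - x_n = (1 + t / a)^-1 (c - x_(n-1)). *)
Lemma nsiwt_synth z n :
  iterate (K z) n = synthv (fun m => (1 - dampm m n)%:S * dotX z (v m)).
Proof.
have iter01 k m : P m -> 0 <= 1 - dampm m k <= 1.
  by move=> /(@dampm01 _ k)/andP[d0 d1]; rewrite subr_ge0 d1 lerBlDr lerDl.
have iter_cvg k :
    cvgn (partial_sum P v (fun m => (1 - dampm m k)%:S * dotX z (v m))).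
  apply: (dominated_is_cvg hdotX vo (x := z)).
  by apply: weight_dominated => m; exact: iter01.
elim: n => [|n IH] /=.
  rewrite -[LHS](synth0 (P := P) (e := v)); apply: eq_synth => m _.
  by rewrite /damp big_geq// subrr rmorph0 mul0r.
have r0 : 0 <= r n.+1 by rewrite ltW ?hr.
have a0 : 0 < alpha n.+1 by exact: halpha.
rewrite IH; set x1 := synthv (fun m => (1 - dampm m n.+1)%:S * _).
suff x1E : KsK_pow dotX rk sigma v ((r n.+1 + 1) / 2) x1 +
    (alpha n.+1)%:S *: x1 = KsK_pow_Ks dotY rk sigma v u (r n.+1) (K z) +
    (alpha n.+1)%:S *: synthv (fun m => (1 - dampm m n)%:S * dotX z (v m)).
  by apply: xget_unique => // x xE; apply: shifted_power_inj r0 a0 _; rewrite x1E.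
rewrite KsK_pow_synth KsK_pow_Ks_synth// -!synth_lin//; try exact: power_cvg.
apply: eq_synth => m Pm; rewrite (synth_coef hdotX vo)//.
rewrite /= !mulrA -!mulrDl -!rmorphM -!rmorphD -rmorphM.
congr (_%:S * _).
rewrite dampS; set t := sigma m `^ _; set a := alpha _; set d := damp _ _ _.
have t0 : 0 < t by exact: power_gt0.
by field; rewrite !gt_eqF ?addr_gt0.
Qed.

Lemma error_synth z n :
  Defs.pinv dotX dotY K (K z) - iterate (K z) n =
  synthv (fun m => (dampm m n)%:S * dotX z (v m)).
Proof.
rewrite pinv_synth nsiwt_synth -scaleN1r -synth_lin; first last.
- apply: (dominated_is_cvg hdotX vo (x := z)).
  apply: weight_dominated => m /(@dampm01 _ n)/andP[d0 d1].
  by rewrite subr_ge0 d1 lerBlDr lerDl.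
- exact: coef_cvg.
apply: eq_synth => m _.
by rewrite rmorphB rmorph1 mulN1r mulrBl mul1r opprB addrCA subrr addr0.
Qed.

Lemma damp_cvg0_converges : (forall m, P m -> dampm m n @[n --> \oo] --> 0) ->
  nsiwt_converges dotX dotY rk sigma v u alpha r K.
Proof.
move=> damp0 _ [z _ <-].
have -> : iterate (K z) = fun n => Defs.pinv dotX dotY K (K z) -
    synthv (fun m => (dampm m n)%:S * dotX z (v m)).
  by apply/funext => n; rewrite -error_synth opprB addrC subrK.
rewrite -[X in _ --> X]subr0; apply: cvgB; first exact: cvg_cst.
by apply: (synth_cvg0 hdotX vo) => // m n; exact: dampm01.
Qed.

(** For y = K (v m) the factor is the component of the error on v m. *)
Lemma converges_damp_cvg0 m : P m ->
  nsiwt_converges dotX dotY rk sigma v u alpha r K ->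
  dampm m n @[n --> \oo] --> 0.
Proof.
move=> Pm conv; have /cvgrPdist_le vconv := conv (K (v m)) (ex_intro2 _ _ _ I erefl).
apply/cvgrPdist_le => d d0.
have dS0 : 0 < d%:S by rewrite -(rmorph0 (scal_of_real S)) scal_lt.
apply: filterS (vconv _ dS0) => n errd.
rewrite sub0r normrN -(scal_le S) -scal_norm_real (le_trans _ errd)//.
rewrite error_synth; apply: (le_trans _ (norm_coef_le hdotX vo _ Pm)).
rewrite (synth_coef hdotX vo)// ?vo// ?eqxx ?mulr1//.
apply: (dominated_is_cvg hdotX vo (x := v m)).
by apply: weight_dominated => k; exact: dampm01.
Qed.

End Iterates.

(** * Convergence *)

Theorem corollary25 (R : realType) (F : numFieldType) (S : scalars R F)
  (X Y : completeNormedModType F)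
  (dotX : {dot X for scal_conj S}) (dotY : {dot Y for scal_conj S})
  (hdotX : forall x : X, dotX x x = `|x| ^+ 2)
  (hdotY : forall y : Y, dotY y y = `|y| ^+ 2)
  (K : {linear X -> Y}) (Ks : Y -> X)
  (hKs : adjoint dotX dotY K Ks)
  (hKcompact : compact_operator K)
  (hKnorm : opnorm S K = 1)
  (rk : option nat) (sigma : nat -> R) (v : nat -> X) (u : nat -> Y)
  (hsve : sve dotX dotY K Ks rk sigma v u)
  (alpha r : nat -> R)
  (halpha : forall k, (0 < k)%N -> 0 < alpha k)
  (hr : forall k, (0 < k)%N -> 0 < r k) :
  (forall rsup : R, 0 <= rsup ->
     ereal_sup [set (r k)%:E | k in [set k | (0 < k)%N]] = rsup%:E ->
     (nsiwt_converges dotX dotY rk sigma v u alpha r K <->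
      ~ cvgn (fun n : nat => \sum_(1 <= k < n.+1) (alpha k)^-1)))
  /\
  (r n @[n --> \oo] --> +oo ->
   (forall m n : nat, (0 < m)%N -> (m <= n)%N -> r m <= r n) ->
   (forall s : R, singular_spectrum rk sigma s -> s != 0 ->
      (fun n : nat => ((\sum_(1 <= k < n.+1) (alpha k)^-1)^-1)%R : R^o)
        =o_\oo (fun n : nat => (s `^ (r n + 1))%R : R^o)) ->
   nsiwt_converges dotX dotY rk sigma v u alpha r K).
Proof.
pose total n : R := \sum_(1 <= k < n.+1) (alpha k)^-1.
have aV0 k : (0 < k)%N -> 0 < (alpha k)^-1 by move=> k0; rewrite invr_gt0 halpha.
have total_nd : {homo total : m n / (m <= n)%N >-> m <= n}.
  apply/nondecreasing_seqP => n.
  have -> : total n.+1 = total n + (alpha n.+1)^-1 by rewrite /total big_nat_recr.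
  by rewrite lerDl ltW ?aV0.
have P0 := in_rank0 hsve hKnorm.
have tgt0 m (Pm : in_rank rk m) := power_gt0 hsve r Pm.
have load_ge (c : R) m n :
    (forall k, (1 <= k < n.+1)%N -> c <= sigma m `^ (r k + 1)) ->
    c * total n <= load alpha (fun k => sigma m `^ (r k + 1)) n.
  move=> ck; rewrite /total /load mulr_sumr big_nat [leRHS]big_nat.
  apply: ler_sum => k kn; rewrite ler_wpM2r ?ck// ltW ?aV0//.
  by case/andP: kn.
split=> [rsup rsup0 rsupE|r_infty r_nd small].
  split=> [conv total_cvg|total_dvg].
    have total_le n : total n <= limn total by exact: nondecreasing_cvgn_le.
    have /cvgrPdist_le/(_ (expR (- limn total) / 2)) :=
      converges_damp_cvg0 hdotX hdotY hKs hsve hKnorm halpha hr P0 conv.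
    have e0 : 0 < expR (- limn total) by exact: expR_gt0.
    move=> /(_ (divr_gt0 e0 (ltr0n _ 2))) [n _ /(_ n (leqnn n))] /=.
    have /andP[d0 _] := dampm01 hsve r halpha n P0.
    rewrite sub0r normrN ger0_norm// leNgt => /negP; apply.
    rewrite (@lt_le_trans _ _ (expR (- limn total)))//.
      by rewrite gtr_pMr// invf_lt1// ltr1n.
    (* As sigma 0 <= 1, the load on v 0 is at most total n. *)
    apply: le_trans (damp_ge halpha (tgt0 _ P0) n).
    rewrite ler_expR lerN2 (le_trans _ (total_le n))// /load big_nat [leRHS]big_nat.
    apply: ler_sum => k /andP[k0 _]; rewrite ler_piMl ?(ltW (aV0 k k0))//.
    by have /andP[] := power01 hdotX hdotY hsve hKnorm (addr_ge0 (ltW (hr k k0)) ler01) P0.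
  apply: (damp_cvg0_converges hdotX hdotY hKs hsve hKnorm halpha hr) => m Pm.
  apply: damp_cvg0 => //; first exact: tgt0.
  have /cvgryPge total_infty := nondecreasing_dvgn_lt total_nd total_dvg.
  have c0 : 0 < sigma m `^ (rsup + 1) by rewrite powR_gt0// (sve_gt0 hsve).
  move=> A A0; apply: filterS (total_infty (A / sigma m `^ (rsup + 1))) => n.
  rewrite ler_pdivrMr// mulrC => /le_trans; apply; apply: load_ge => k /andP[k0 _].
  rewrite ger_powR ?(sve_gt0 hsve) ?(sigma_le1 hdotX hdotY hsve hKnorm)// lerD2r -lee_fin -rsupE.
  by apply: ereal_sup_ubound; exists k.
apply: (damp_cvg0_converges hdotX hdotY hKs hsve hKnorm halpha hr) => m Pm.
apply: damp_cvg0 => //; first exact: tgt0.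
have sm : singular_spectrum rk sigma (sigma m).
  by apply: subset_closure; exists m.
have sm0 := sve_gt0 hsve Pm.
move=> A A0; have /eqoP/(_ A^-1) := small _ sm (lt0r_neq0 sm0).
rewrite invr_gt0 => /(_ A0) small_m; near=> n.
have n0 : (0 < n)%N by near: n; exists 1%N.
have total0 : 0 < total n.
  apply: lt_le_trans (total_nd 1%N n n0).
  by rewrite /total big_nat1 aV0.
have : `|(total n)^-1| <= A^-1 * `|sigma m `^ (r n + 1)| by near: n.
rewrite !ger0_norm ?invr_ge0 ?powR_ge0 ?(ltW total0)//.
rewrite -lef_pV2 ?posrE ?invr_gt0 ?mulr_gt0 ?powR_gt0 ?invr_gt0//.
rewrite invfM !invrK ler_pdivrMr ?powR_gt0// mulrC => /le_trans; apply.
apply: load_ge => k /andP[k0 kn].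
rewrite ger_powR ?sm0 ?(sigma_le1 hdotX hdotY hsve hKnorm)// lerD2r.
exact: r_nd.
Unshelve. all: by end_near. Qed.
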